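(* Let $r\ge2$ be a prime, let $t\ne0,\pm1,\pm2$ be rational, and let $1\le s\le r-1$. The sequence $\{U_{kr+s}(t)\}_{k\in\mathbb Z}$ is a second order linear recursive sequence, satisfying $x_{k+1}=C_r(t)\,x_k-x_{k-1}$, and the set of primes $p\in\Pi(t)$ which divide the numerator of some element of this sequence is equal to $\Pi_0(t,r)$ if $r\ge3$, and to $\Pi_0(t,2)\cup\Pi_1(t,2)$ if $r=2$.
   Context: For rational $t$ put $D_t=\begin{pmatrix}0&-1\\1&t\end{pmatrix}$. Chebyshev polynomials: $C_0(x)=2$, $C_1(x)=x$, $C_{n+1}=xC_n-C_{n-1}$; and $U_0(x)=0$, $U_1(x)=1$, $U_{n+1}=xU_n-U_{n-1}$ for all $n\in\mathbb Z$. $\Pi(t)$ is the set of primes $p\ge 3$, $p\neq r$, not dividing the denominator of $t$. For $p\in\Pi(t)$ the index $\chi(t,p)$ is the smallest integer $k\ge1$ with $D_t^k\equiv I \pmod p$. For $j\ge 0$, $\Pi_j(t,r)=\{p\in\Pi(t) : r^j \,\|\, \chi(t,p)\}$ (exact power of $r$ dividing the index). Numerators refer to rational numbers in lowest terms. *)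

(* Defs.v *)
From mathcomp Require Import all_boot all_order all_algebra.

Set Implicit Arguments.
Unset Strict Implicit.
Unset Printing Implicit Defensive.

Import Order.TTheory GRing.Theory Num.Theory.
Local Open Scope ring_scope.

(* [rec_nat a b n] is the n-th term (n >= 0) of the sequence starting with
   a, b and satisfying f_{n+1} = X f_n - f_{n-1}. *)
Fixpoint rec_nat (a b : {poly rat}) (n : nat) : {poly rat} :=
  if n is m.+1 then rec_nat b ('X * b - a) m else a.

(* The solution on Z of the same recurrence, with values a at 0 and b at 1.
   The recurrence is symmetric under n |-> 1 - n, so f_{-(n+1)} is the term
   of rank n+2 of the sequence starting with b, a. *)
Definition rec_int (a b : {poly rat}) (n : int) : {poly rat} :=
  match n with
  | Posz m => rec_nat a b m
  | Negz m => rec_nat b a m.+2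
  end.

Definition chebC : int -> {poly rat} := rec_int 2%:R 'X.
Definition chebU : int -> {poly rat} := rec_int 0 1.

Lemma rec_natS a b n :
  rec_nat a b n.+2 = 'X * rec_nat a b n.+1 - rec_nat a b n.
Proof. by elim: n a b => [//|n IHn] a b; apply: IHn. Qed.

Lemma rec_intS a b (n : int) :
  rec_int a b (n + 1) = 'X * rec_int a b n - rec_int a b (n - 1).
Proof.
case: n => [[|n]|n].
- by rewrite /= opprB addrC subrK.
- have -> : Posz n.+1 + 1 = Posz n.+2 by rewrite -PoszD addn1.
  have -> : Posz n.+1 - 1 = Posz n by rewrite -[n.+1]addn1 PoszD addrK.
  exact: rec_natS.
- have -> : Negz n - 1 = Negz n.+1.
    by rewrite !NegzE -opprD -PoszD addn1.
  have -> : rec_int a b (Negz n + 1) = rec_nat b a n.+1.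
    case: n => [//|n].
    have -> // : Negz n.+1 + 1 = Negz n.
    by rewrite !NegzE -[n.+2]addn1 PoszD opprD subrK.
  by rewrite /rec_int [rec_nat b a n.+3]rec_natS opprB addrC subrK.
Qed.

Lemma chebC_rec :
  [/\ chebC 0 = 2%:R, chebC 1 = 'X &
      forall n : int, chebC (n + 1) = 'X * chebC n - chebC (n - 1)].
Proof. by split=> // n; apply: rec_intS. Qed.

Lemma chebU_rec :
  [/\ chebU 0 = 0, chebU 1 = 1 &
      forall n : int, chebU (n + 1) = 'X * chebU n - chebU (n - 1)].
Proof. by split=> // n; apply: rec_intS. Qed.

Definition Dmx (t : rat) : 'M[rat]_2 :=
  \matrix_(i < 2, j < 2)
    nth 0 (nth [::] [:: [:: 0; -1];
                        [:: 1;  t]] i) j.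

Definition dvd_numer (p : nat) (x : rat) : bool := (p%:Z %| numq x)%Z.

(* As numq and denq are coprime, for p prime this says that all entries of
   A - B lie in the ideal generated by p of the localization of Z at p. *)
Definition mx_congr (p : nat) (A B : 'M[rat]_2) : Prop :=
  forall i j : 'I_2, dvd_numer p (A i j - B i j).

Definition in_Pi (r : nat) (t : rat) (p : nat) : Prop :=
  [/\ prime p, (3 <= p)%N, p <> r & ~~ (p%:Z %| denq t)%Z].

(* [is_index t p k] is the graph of the index: k = chi(t, p). *)
Definition is_index (t : rat) (p k : nat) : Prop :=
  [/\ (1 <= k)%N,
      mx_congr p (Dmx t ^+ k) 1 &
      forall m : nat, (1 <= m)%N -> mx_congr p (Dmx t ^+ m) 1 -> (k <= m)%N].

Definition exact_pow_dvd (r j n : nat) : bool :=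
  (r ^ j %| n)%N && ~~ (r ^ j.+1 %| n)%N.

Definition in_Pi_j (j : nat) (t : rat) (r p : nat) : Prop :=
  in_Pi r t p /\ exists2 k : nat, is_index t p k & exact_pow_dvd r j k.

(* Main.v *)
Require Import Defs.
From mathcomp Require Import all_boot all_order all_algebra zify ring.

Import Order.TTheory GRing.Theory Num.Theory.
Local Open Scope ring_scope.

(** Over any field in which 2 is nonzero, the lower left entry U_n(a) of the
    n-th power of the companion matrix D of X^2 - a X + 1 vanishes exactly when
    D^(2n) = 1 ([companion_exp_lower_left]).  Indeed D^n is a combination
    of D and 1, so U_n(a) = 0 makes it a scalar of determinant 1, hence of
    square 1; conversely a matrix M of determinant 1 satisfies
    M^2 = (tr M) M - 1, so M^2 = 1 forces (tr M) M = 2 and M is scalar.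

    Reducing a = t modulo p turns this into: p divides the numerator of
    U_n(t) if and only if the index k of t at p divides 2n
    ([dvd_numer_chebU]).  The theorem is then a question about the residue
    class of s modulo r: it meets the multiples of k (r odd) exactly when r
    does not divide k, and there is an odd n with k dividing 2n (r = 2)
    exactly when 4 does not divide k.  The index exists as soon as p divides
    some U_n(t) with n nonzero, since then D^(2n) = 1 modulo p.

    The recurrence is the identity U_(n+m) + U_(n-m) = C_m U_n. *)

(** * Chebyshev identities *)

(** This contains both the recurrence along an arithmetic progression of
    ranks with difference m and, at n = 0, the oddness of U. *)
Lemma chebUD_B (m : nat) (n : int) :
  chebU (n + m%:Z) + chebU (n - m%:Z) = chebC m%:Z * chebU n.
Proof.
case: chebC_rec => C0 C1 CS; case: chebU_rec => _ _ US.
(* The recurrence has order two, so two consecutive values of m are carried. *)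
suff: chebU (n + m%:Z) + chebU (n - m%:Z) = chebC m%:Z * chebU n /\
      chebU (n + m.+1%:Z) + chebU (n - m.+1%:Z) = chebC m.+1%:Z * chebU n.
  by case.
elim: m => [|m [IH0 IH1]].
  by rewrite C0 C1 addr0 US subrK mulr_natl mulr2n.
split=> //.
have -> : n + m.+2%:Z = (n + m.+1%:Z) + 1 by lia.
have -> : chebU (n - m.+2%:Z) =
          'X * chebU (n - m.+1%:Z) - chebU (n - m%:Z).
  have -> : n - m%:Z = (n - m.+1%:Z) + 1 by lia.
  have -> : n - m.+2%:Z = (n - m.+1%:Z) - 1 by lia.
  by rewrite US; ring.
have -> : m.+2%:Z = m.+1%:Z + 1 by lia.
rewrite US CS.
have -> : n + m.+1%:Z - 1 = n + m%:Z by lia.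
have -> : m.+1%:Z - 1 = m%:Z by lia.
by rewrite mulrBl -IH0 -mulrA -IH1; ring.
Qed.

Lemma chebUN (n : nat) : chebU (- n%:Z) = - chebU n%:Z.
Proof.
case: chebU_rec => U0 _ _.
have := chebUD_B n 0; rewrite U0 mulr0 !add0r => /eqP.
by rewrite addrC addr_eq0 => /eqP.
Qed.

(** * Powers of the companion matrix *)

(** The entries are laid out as in [Dmx], which is the case R = rat by
    conversion. *)
Definition companion (R : comNzRingType) (a : R) : 'M[R]_2 :=
  \matrix_(i < 2, j < 2)
    nth 0 (nth [::] [:: [:: 0; -1]; [:: 1; a]] i) j.

Lemma matrix2P (R : Type) (A B : 'M[R]_2) :
  A 0 0 = B 0 0 -> A 0 1 = B 0 1 -> A 1 0 = B 1 0 -> A 1 1 = B 1 1 -> A = B.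
Proof.
move=> h00 h01 h10 h11; apply/matrixP => i j.
have I2 (k : 'I_2) : k = 0 \/ k = 1.
  by case: k => [[|[|[]]]] // ?; [left | right]; apply: val_inj.
by case: (I2 i) => ->; case: (I2 j) => ->.
Qed.

Lemma sum_ord2 (R : nmodType) (f : 'I_2 -> R) : \sum_i f i = f 0 + f 1.
Proof.
by rewrite !big_ord_recl big_ord0 addr0 (_ : lift _ _ = 1) //; apply: val_inj.
Qed.

Lemma det_mx22 (R : comNzRingType) (M : 'M[R]_2) :
  \det M = M 0 0 * M 1 1 - M 0 1 * M 1 0.
Proof.
rewrite (expand_det_row M 0) sum_ord2 /cofactor !det_mx11 !mxE /=.
rewrite addn0 addn1 expr0 expr1 mul1r mulN1r mulrN.
by congr (_ * M _ _ - _ * M _ _); apply: val_inj.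
Qed.

(** The Cayley-Hamilton relation in dimension 2. *)
Lemma sqr_mx2_det1 (R : comNzRingType) (M : 'M[R]_2) :
  \det M = 1 -> M ^+ 2 = \tr M *: M - 1.
Proof.
rewrite det_mx22 => detM.
have E (i j : 'I_2) :
    (\tr M *: M - 1) i j = (M 0 0 + M 1 1) * M i j - (i == j)%:R.
  by rewrite !mxE /mxtrace sum_ord2.
have E2 (i j : 'I_2) : (M ^+ 2) i j = M i 0 * M 0 j + M i 1 * M 1 j.
  by rewrite expr2 mxE sum_ord2.
by apply: matrix2P; rewrite E E2 /= ?subr0 -?detM; ring.
Qed.

Section Companion.

Variables (R : comNzRingType) (a : R).
Notation D := (companion R a).

Lemma det_companion : \det D = 1.
Proof. by rewrite det_mx22 !mxE /= mul0r mulN1r opprK add0r. Qed.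

Lemma det_companion_exp n : \det (D ^+ n) = 1.
Proof.
elim: n => [|n IHn]; first by rewrite expr0 det1.
by rewrite exprS det_mulmx det_companion IHn mulr1.
Qed.

Lemma sqr_companion : D ^+ 2 = a *: D - 1.
Proof.
rewrite (sqr_mx2_det1 _ _ det_companion); congr (_ *: _ - _).
by rewrite /mxtrace sum_ord2 !mxE /= add0r.
Qed.

Lemma companion_expSS n : D ^+ n.+2 = a *: D ^+ n.+1 - D ^+ n.
Proof.
by rewrite -(addn2 n) exprD sqr_companion mulrBr mulr1 -scalerAr -exprSr.
Qed.

Lemma companion_exp_span n : exists u v : R, D ^+ n = u *: D + v%:M.
Proof.
elim: n => [|n [u [v IHn]]].
  by exists 0, 1; rewrite scale0r add0r expr0.
exists (u * a + v), (- u).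
rewrite exprSr IHn mulrDl -scalerAl -expr2 sqr_companion.
rewrite -[v%:M]scalemx1 -scalerAl mul1r scalerBr scalerA scalerDl.
by rewrite -[(- u)%:M]scalemx1 scaleNr addrAC.
Qed.

Lemma companion_exp_scalar n :
  (D ^+ n) 1 0 = 0 -> exists v : R, D ^+ n = v%:M.
Proof.
case: (companion_exp_span n) => u [v ->].
rewrite !mxE /= mulr1 mulr0n addr0 => ->.
by exists v; rewrite scale0r add0r.
Qed.

End Companion.

(** U_n(a) = 0 says that D^n is scalar, and among the matrices of
    determinant 1 the scalar ones are exactly the square roots of 1, as 2 is
    invertible. *)
Lemma companion_exp_lower_left (F : fieldType) (a : F) (n : nat) :
  2%:R != 0 :> F ->
  ((companion F a ^+ n) 1 0 == 0) = (companion F a ^+ (2 * n) == 1).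
Proof.
move=> nz2; have detDn := det_companion_exp F a n.
rewrite mulnC exprM; apply/eqP/eqP => [/companion_exp_scalar [v Dn]|sqrDn].
  move: detDn; rewrite Dn det_scalar => v2.
  by rewrite -[v%:M]scalemx1 exprZn v2 scale1r expr1n.
move: sqrDn; rewrite (sqr_mx2_det1 _ _ detDn).
set M := companion F a ^+ n => /(canRL (subrK _)) trM.
have tr00 : \tr M * M 0 0 = 2%:R.
  by move/matrixP/(_ 0 0): trM; rewrite !mxE.
have tr10 : \tr M * M 1 0 = 0.
  by move/matrixP/(_ 1 0): trM; rewrite !mxE /= addr0.
move/eqP: tr10; rewrite mulf_eq0 => /orP [/eqP trM0|/eqP //].
by move: nz2; rewrite -tr00 trM0 mul0r eqxx.
Qed.

Lemma chebU_companion (t : rat) (n : nat) :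
  (chebU n%:Z).[t] = (companion _ t ^+ n) 1 0.
Proof.
have rec m : (chebU m.+2%:Z).[t] = t * (chebU m.+1%:Z).[t] - (chebU m%:Z).[t].
  rewrite [chebU m.+2%:Z](rec_natS 0 1).
  by rewrite hornerD hornerN mulrC hornerMX mulrC.
suff: (chebU n%:Z).[t] = (companion _ t ^+ n) 1 0 /\
      (chebU n.+1%:Z).[t] = (companion _ t ^+ n.+1) 1 0 by case.
elim: n => [|n [IH0 IH1]].
  by rewrite expr0 expr1 !mxE /= /chebU /= hornerC hornerE.
by split=> //; rewrite rec IH0 IH1 companion_expSS !mxE.
Qed.

(** * Reduction modulo p *)

(** The graph of reduction modulo p on the rationals whose denominator is
    prime to p, with F a field of characteristic p.  A relation allowing any
    representing fraction avoids normalizing sums and products. *)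
Definition reduces (F : fieldType) (x : rat) (a : F) : Prop :=
  exists n d : int,
    [/\ d%:~R != 0 :> F, x = n%:~R / d%:~R & a = n%:~R / d%:~R].

Section Reduction.

Variables (F : fieldType) (p : nat).
Hypothesis (charF : p \in [pchar F]).

Lemma intr_neq0_rat (d : int) : d%:~R != 0 :> F -> d%:~R != 0 :> rat.
Proof. by apply: contraNneq => /eqP; rewrite intr_eq0 => /eqP ->. Qed.

Lemma reduces_int (n : int) : reduces F n%:~R n%:~R.
Proof. by exists n, 1; rewrite !divr1 oner_neq0. Qed.

Lemma reducesD x y a b :
  reduces F x a -> reduces F y b -> reduces F (x + y) (a + b).
Proof.
move=> [n [d [nzd -> ->]]] [m [e [nze -> ->]]].
exists (n * e + m * d), (d * e); rewrite !rmorphD !rmorphM /=.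
by rewrite mulf_neq0 // !addf_div ?intr_neq0_rat.
Qed.

Lemma reducesM x y a b :
  reduces F x a -> reduces F y b -> reduces F (x * y) (a * b).
Proof.
move=> [n [d [nzd -> ->]]] [m [e [nze -> ->]]].
by exists (n * m), (d * e); rewrite !rmorphM /= mulf_neq0 // !mulf_div.
Qed.

Lemma reducesN x a : reduces F x a -> reduces F (- x) (- a).
Proof.
by move=> [n [d [nzd -> ->]]]; exists (- n), d; rewrite !rmorphN /= !mulNr.
Qed.

Lemma reduces_exists x :
  ~~ (p%:Z %| denq x)%Z -> exists a : F, reduces F x a.
Proof.
rewrite (dvdz_pcharf charF) => nzd.
exists ((numq x)%:~R / (denq x)%:~R), (numq x), (denq x).
by rewrite divq_num_den.
Qed.

Lemma dvd_numer_reduces x a : reduces F x a -> dvd_numer p x = (a == 0).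
Proof.
move=> [n [d [nzd xE ->]]]; rewrite mulf_eq0 invr_eq0 (negbTE nzd) orbF.
have pr_p := pcharf_prime charF.
have crossE : numq x * d = n * denq x.
  apply: (@intr_inj rat); rewrite !rmorphM /=.
  have /eqP := etrans (divq_num_den x) xE.
  by rewrite eqr_div ?(intr_neq0_rat d) ?intr_eq0 ?denq_neq0 // => /eqP.
have numF : (numq x)%:~R * d%:~R = n%:~R * (denq x)%:~R :> F.
  by rewrite -!rmorphM /= crossE.
rewrite /dvd_numer (dvdz_pcharf charF); apply/eqP/eqP => [num0 | n0].
  move: numF; rewrite num0 mul0r => /esym/eqP; rewrite mulf_eq0.
  case/orP=> [/eqP //|].
  (* p cannot divide both the numerator and the denominator *)
  rewrite -(dvdz_pcharf charF) dvdzE => pden.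
  move/eqP: num0; rewrite -(dvdz_pcharf charF) dvdzE => pnum.
  have := coprime_num_den x; rewrite /coprime => /eqP g1.
  have: (p %| gcdn `|numq x| `|denq x|)%N by rewrite dvdn_gcd pnum pden.
  by rewrite g1 dvdn1 => /eqP p1; move: pr_p; rewrite p1.
move: numF; rewrite n0 mul0r => /eqP; rewrite mulf_eq0 (negbTE nzd) orbF.
by move/eqP.
Qed.

Variables (t : rat) (a : F).
Hypothesis (red_t : reduces F t a).

Lemma reduces_companion_exp n (i j : 'I_2) :
  reduces F ((companion _ t ^+ n) i j) ((companion F a ^+ n) i j).
Proof.
have red_nat (b : bool) : reduces F b%:R b%:R by apply: (reduces_int b).
elim: n i j => [|n IHn] i j; first by rewrite !expr0 !mxE.
rewrite !exprS !mxE; apply: big_rec2 => [|k x y _ red].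
  exact: (red_nat false).
apply: reducesD => //; apply: reducesM => //; rewrite !mxE.
case: i k {red} => [[|[|[]]]] //= _ [[|[|[]]]] //= _.
- exact: (red_nat false).
- exact/reducesN/(red_nat true).
- exact: (red_nat true).
Qed.

Lemma mx_congr_companion_exp n :
  mx_congr p (Dmx t ^+ n) 1 <-> companion F a ^+ n = 1.
Proof.
have red (i j : 'I_2) :
    dvd_numer p ((Dmx t ^+ n) i j - (1 : 'M[rat]_2) i j) =
    ((companion F a ^+ n) i j - (1 : 'M[F]_2) i j == 0).
  apply: dvd_numer_reduces; apply: reducesD.
    exact: reduces_companion_exp.
  by apply: reducesN; have := reduces_companion_exp 0 i j; rewrite !expr0.
split=> [congr1|exp1 i j].
  by apply/matrixP => i j; move: (congr1 i j); rewrite red subr_eq0 => /eqP.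
by rewrite red exp1 subrr.
Qed.

(** Both sides are about the order of D modulo p: minimality excludes a
    nonzero remainder of n by k. *)
Lemma is_index_dvdn k n :
  is_index t p k -> (k %| n)%N = (companion F a ^+ n == 1).
Proof.
case=> k_gt0 /mx_congr_companion_exp expk k_min; apply/idP/eqP => [|expn].
  by case/dvdnP=> q ->; rewrite mulnC exprM expk expr1n.
have expr_mod : companion F a ^+ (n %% k) = 1.
  by rewrite -expn [in RHS](divn_eq n k) exprD mulnC exprM expk expr1n mul1r.
rewrite /dvdn; case: (posnP (n %% k)%N) => [//|mod_gt0].
have := k_min _ mod_gt0 (proj2 (mx_congr_companion_exp _) expr_mod).
by rewrite leqNgt ltn_mod k_gt0.
Qed.

Lemma dvd_numer_chebU_exp (n : int) :
  (3 <= p)%N ->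
  dvd_numer p (chebU n).[t] = (companion F a ^+ (2 * `|n|) == 1).
Proof.
move=> p_ge3; have nz2 : 2%:R != 0 :> F.
  rewrite -(dvdn_pcharf charF); apply/negP => /(dvdn_leq (isT : 0 < 2)%N).
  by rewrite leqNgt p_ge3.
rewrite -companion_exp_lower_left //.
have red m := dvd_numer_reduces _ _ (reduces_companion_exp m 1 0).
have [nE | nE] : n = `|n|%N%:Z \/ n = - `|n|%N%:Z by lia.
  by rewrite {1}nE chebU_companion red.
rewrite {1}nE chebUN hornerN chebU_companion -red.
by rewrite /dvd_numer numqN !dvdzE abszN.
Qed.

End Reduction.

(** * The index of t at p *)

Lemma in_Pi_reduction (r : nat) (t : rat) (p : nat) :
  in_Pi r t p ->
  p \in [pchar 'F_p] /\ exists a : 'F_p, reduces 'F_p t a.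
Proof.
case=> pr_p _ _ p_den; have charF := pchar_Fp pr_p.
by split=> //; apply: reduces_exists p_den.
Qed.

Lemma dvd_numer_chebU (r : nat) (t : rat) (p k : nat) (n : int) :
  in_Pi r t p -> is_index t p k ->
  dvd_numer p (chebU n).[t] = (k %| 2 * `|n|)%N.
Proof.
move=> pPi idx; have [charF [a red_t]] := in_Pi_reduction _ _ _ pPi.
case: pPi => _ p_ge3 _ _.
rewrite (dvd_numer_chebU_exp _ _ charF _ _ red_t) //.
by rewrite (is_index_dvdn _ _ charF _ _ red_t).
Qed.

(** The relation D^(2n) = 1 modulo p provides a positive exponent; the index
    is the least one. *)
Lemma is_index_exists (r : nat) (t : rat) (p : nat) (n : int) :
  in_Pi r t p -> n != 0 -> dvd_numer p (chebU n).[t] ->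
  exists k, is_index t p k.
Proof.
move=> pPi nz_n; have [charF [a red_t]] := in_Pi_reduction _ _ _ pPi.
case: pPi => _ p_ge3 _ _.
rewrite (dvd_numer_chebU_exp _ _ charF _ _ red_t) // => exp1.
have exP : exists m, (0 < m)%N && (companion 'F_p a ^+ m == 1).
  by exists (2 * `|n|)%N; rewrite muln_gt0 absz_gt0 nz_n.
case: (ex_minnP exP) => k /andP [k_gt0 /eqP expk] k_min.
have congrE := mx_congr_companion_exp _ _ charF _ _ red_t.
exists k; split=> // [|m m_gt0 /congrE expm]; first exact/congrE.
by apply: k_min; rewrite m_gt0 expm eqxx.
Qed.

(** * Residue classes modulo r *)

Lemma progression_dvdn (r s k : nat) :
  coprime r k -> (s < r)%N -> exists q : nat, (k %| q * r + s)%N.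
Proof.
move=> co_rk s_lt; exists (chinese r k s 0 %/ r)%N.
rewrite -{2}(modn_small s_lt) -(chinese_modl co_rk s 0) -divn_eq.
by rewrite /dvdn chinese_modr // mod0n.
Qed.

Lemma progression_ndvdn (r s : nat) (q : int) :
  (1 <= s <= r - 1)%N -> ~~ (r %| absz (q * r%:Z + s%:Z)%R)%N.
Proof.
case/andP=> s_gt0 s_le; have s_lt : (s < r)%N by lia.
rewrite -[r in (r %| _)%N]/(absz r%:Z) -dvdzE.
rewrite rpredDl ?dvdz_mull // dvdzE /=.
by apply/negP => /(dvdn_leq s_gt0); rewrite leqNgt s_lt.
Qed.

Theorem mainTheorem15 (r : nat) (t : rat) (s : nat)
  (hr : prime r)
  (ht0 : t <> 0) (ht1 : t <> 1) (htN1 : t <> -1)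
  (ht2 : t <> 2%:R) (htN2 : t <> - 2%:R)
  (hs : (1 <= s <= r - 1)%N) :
  let x := fun k : int => (chebU (k * r%:Z + s%:Z)).[t] in
  (forall k : int, x (k + 1) = (chebC r%:Z).[t] * x k - x (k - 1)) /\
  ((3 <= r)%N ->
     forall p : nat,
       (in_Pi r t p /\ exists k : int, dvd_numer p (x k)) <->
       in_Pi_j 0 t r p) /\
  (r = 2%N ->
     forall p : nat,
       (in_Pi r t p /\ exists k : int, dvd_numer p (x k)) <->
       (in_Pi_j 0 t 2 p \/ in_Pi_j 1 t 2 p)).
Proof.
move=> x.
have ndvd q := progression_ndvdn _ _ q hs.
have index p q : in_Pi r t p -> dvd_numer p (x q) ->
    exists2 k, is_index t p k & (k %| 2 * absz (q * r%:Z + s%:Z)%R)%N.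
  move=> pPi dvd_x; have nz : q * r%:Z + s%:Z != 0.
    by apply: contraNneq (ndvd q) => ->.
  have [k idx] := is_index_exists _ _ _ _ pPi nz dvd_x.
  by exists k => //; rewrite -(dvd_numer_chebU _ _ _ _ _ pPi idx).
split=> [q|].
  rewrite /x -hornerM -chebUD_B // hornerD.
  have -> : (q + 1) * r%:Z + s%:Z = q * r%:Z + s%:Z + r%:Z by ring.
  have -> : (q - 1) * r%:Z + s%:Z = q * r%:Z + s%:Z - r%:Z by ring.
  by rewrite addrK.
split=> [r_ge3 p | r2 p].
  split=> [[pPi [q /(index _ _ pPi) [k idx k_dvd]]]|].
    split=> //; exists k => //; rewrite /exact_pow_dvd expn0 dvd1n expn1 /=.
    apply/negP => rk; move: (dvdn_trans rk k_dvd).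
    rewrite Euclid_dvdM // (negbTE (ndvd q)) orbF => /dvdn_leq.
    by move/(_ isT); rewrite leqNgt r_ge3.
  case=> pPi [k idx]; rewrite /exact_pow_dvd expn0 dvd1n expn1 /= => rNk.
  split=> //; case: (progression_dvdn r s k) => [||q k_dvd].
  - by rewrite prime_coprime.
  - by lia.
  exists q%:Z; rewrite /x (dvd_numer_chebU _ _ _ _ _ pPi idx).
  by rewrite -PoszM -PoszD absz_nat dvdn_mull.
have s1 : s = 1%N by lia.
subst r s; rewrite /x /in_Pi_j /exact_pow_dvd expn0 expn1.
split=> [[pPi [q /(index _ _ pPi) [k idx k_dvd]]]|].
  have Nk4 : ~~ (4 %| k)%N.
    apply: contra (ndvd q) => k4.
    by rewrite -(@dvdn_pmul2l 2) //; apply: dvdn_trans k4 k_dvd.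
  case k2: (2 %| k)%N; [right | left]; split=> //; exists k => //.
    by rewrite k2.
  by rewrite dvd1n k2.
(* The odd m serving as the rank n is k itself when k is odd, and k / 2 when
   k is twice an odd number. *)
have solution k m : in_Pi 2 t p -> is_index t p k -> odd m -> (k %| 2 * m)%N ->
    in_Pi 2 t p /\ exists q : int, dvd_numer p (chebU (q * 2%:Z + 1%:Z)).[t].
  move=> pPi idx odd_m k_dvd; split=> //; exists m./2%:Z.
  rewrite (dvd_numer_chebU _ _ _ _ _ pPi idx).
  rewrite -PoszM -PoszD absz_nat muln2 addn1.
  by have := odd_double_half m; rewrite odd_m add1n => ->.
case=> [[pPi [k idx /andP [_ k2]]] | [pPi [k idx /andP [k2 k4]]]].
  apply: (solution k k) => //; last exact: dvdn_mull.
  by move: k2; rewrite dvdn2 negbK.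
have kE : k = (2 * (k %/ 2))%N by rewrite mulnC divnK.
apply: (solution k (k %/ 2)%N) => //; last by rewrite -kE.
apply: contraNT k4; rewrite -dvdn2 => half2.
by rewrite kE dvdn_pmul2l.
Qed.
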